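(* For every $m \geq 0$ and $n \geq 0$, the $m$-th iterate of the Thue--Morse transform satisfies \[ a_m(n) \;=\; \bigoplus_{\substack{p\geq 0 \\ p\,\mathbin{\&}\,m = 0}} b_p(n), \] where $\bigoplus$ denotes the XOR (addition modulo~$2$) and $\&$ the bitwise AND.
   Context: For $n\ge 0$ write $n=\sum_{p\ge 0} b_p(n)2^p$ with $b_p(n)=\lfloor n/2^p\rfloor \bmod 2$, and $s_2(n)=\sum_p b_p(n)$. The Thue--Morse sequence is $t(n)=s_2(n)\bmod 2$. For a binary sequence $\sigma\colon\mathbb N\to\{0,1\}$ with $\sigma(0)=0$, $\sigma(1)=1$, taking each value infinitely often, let $v_\sigma(n)$ (resp. $u_\sigma(n)$) be the increasing enumeration of positions where $\sigma=0$ (resp. $\sigma=1$). The Thue--Morse transform $\tau=\mathcal T(\sigma)$ is the unique binary sequence with $\tau(v_\sigma(n))=\tau(n)$, $\tau(u_\sigma(n))=1-\tau(n)$, $\tau(0)=0$. The iterated tower is defined by $a_0=t$ (the Thue--Morse sequence) and $a_{m+1}=\mathcal T(a_m)$ for $m\ge 0$. *)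

(* Defs.v *)
From mathcomp Require Import all_boot.

Set Implicit Arguments.
Unset Strict Implicit.
Unset Printing Implicit Defensive.

Definition bit (p n : nat) : bool := odd (n %/ 2 ^ p).

Lemma bit_modn p n : bit p n = n %/ 2 ^ p %% 2 :> nat.
Proof. by rewrite /bit modn2. Qed.

Lemma bit_ge p n : n <= p -> bit p n = false.
Proof.
move=> np; rewrite /bit divn_small //.
exact: leq_ltn_trans np (ltn_expl p (ltnSn 1)).
Qed.

Lemma bit0 n : bit 0 n = odd n.
Proof. by rewrite /bit expn0 divn1. Qed.

Lemma bitS p n : bit p.+1 n = bit p n./2.
Proof. by rewrite /bit expnS divnMA divn2. Qed.

(* Bits of n at positions p >= n vanish, so the sum over all p >= 0 is the sum
   over p < n; any larger bound gives the same value (s2_widen). *)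
Definition s2 (n : nat) : nat := \sum_(p < n) bit p n.

Lemma s2_widen n N : n <= N -> s2 n = \sum_(p < N) bit p n.
Proof.
move=> nN; rewrite /s2 (big_ord_widen N (fun p => bit p n : nat) nN).
rewrite big_mkcond; apply: eq_bigr => p _.
by case: ltnP => // np; rewrite bit_ge.
Qed.

(* In the same way the XOR over all p >= 0 with p & m = 0 can be cut at p < n. *)
Lemma xor_widen m n N : n <= N ->
  \big[addb/false]_(p < n | Nat.land p m == 0) bit p n
  = \big[addb/false]_(p < N | Nat.land p m == 0) bit p n.
Proof.
move=> nN; rewrite (big_ord_widen_cond N (fun p => Nat.land p m == 0) (bit^~ n) nN).
rewrite big_mkcond [RHS]big_mkcond; apply: eq_bigr => p _.
by case: eqP => //= _; case: ltnP => // np; rewrite bit_ge.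
Qed.

Definition thue_morse (n : nat) : bool := odd (s2 n).

Record binseq := BinSeq {
  seqfun :> nat -> bool;
  binseq0 : seqfun 0 = false;
  binseq1 : seqfun 1 = true;
  binseq_inf : forall (b : bool) (N : nat), exists n, (N <= n) && (seqfun n == b)
}.

Lemma s2_half n : s2 n = odd n + s2 n./2.
Proof.
rewrite (s2_widen (leqnSn n)) big_ord_recl /= bit0; congr addn.
rewrite (@s2_widen _ n); last by rewrite leq_half_double -addnn -addnS leq_addr.
by apply: eq_bigr => p _; rewrite -bitS.
Qed.

Lemma thue_morse0 : thue_morse 0 = false.
Proof. by rewrite /thue_morse /s2 big_ord0. Qed.

Lemma thue_morse1 : thue_morse 1 = true.
Proof. by rewrite /thue_morse s2_half /= /s2 big_ord0. Qed.

Lemma thue_morse_inf (b : bool) N : exists n, (N <= n) && (thue_morse n == b).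
Proof.
exists ((thue_morse N (+) b) + N.*2).
rewrite -addnn addnA leq_addl /= -addnA addnn.
by rewrite /thue_morse s2_half half_bit_double !oddD odd_double; case: b; case: (odd (s2 N)).
Qed.

Definition thue_morse_seq : binseq :=
  BinSeq thue_morse0 thue_morse1 thue_morse_inf.

Definition next_pos (sigma : binseq) (b : bool) (N : nat) : nat :=
  ex_minn (binseq_inf sigma b N).

(* pos sigma b is the increasing enumeration of {k | sigma k = b}; see
   pos_homo and posP. *)
Fixpoint pos (sigma : binseq) (b : bool) (n : nat) : nat :=
  if n is n'.+1 then next_pos sigma b (pos sigma b n').+1
  else next_pos sigma b 0.

Definition v_ (sigma : binseq) : nat -> nat := pos sigma false.
Definition u_ (sigma : binseq) : nat -> nat := pos sigma true.

Lemma next_posP (sigma : binseq) b N :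
  [/\ N <= next_pos sigma b N, sigma (next_pos sigma b N) = b
    & forall k, N <= k -> sigma k = b -> next_pos sigma b N <= k].
Proof.
rewrite /next_pos; case: ex_minnP => k /andP[Nk /eqP kb] kmin; split=> // j Nj jb.
by apply: kmin; rewrite Nj jb eqxx.
Qed.

Lemma pos_homo sigma b : {homo pos sigma b : m n / m < n}.
Proof.
apply: homo_ltn => [|n]; first exact: ltn_trans.
by have [] := next_posP sigma b (pos sigma b n).+1.
Qed.

Lemma pos_val (sigma : binseq) b n : sigma (pos sigma b n) = b.
Proof.
case: n => [|n]; first by have [] := next_posP sigma b 0.
by have [] := next_posP sigma b (pos sigma b n).+1.
Qed.

Lemma leq_pos sigma b n : n <= pos sigma b n.
Proof. by elim: n => // n IH; apply: leq_ltn_trans IH (pos_homo _ _ (ltnSn n)). Qed.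

Lemma posP (sigma : binseq) b k : sigma k = b <-> exists n, pos sigma b n = k.
Proof.
split=> [kb|[n <-]]; last exact: pos_val.
have: exists n, k <= pos sigma b n by exists k; apply: leq_pos.
move=> ex; case: (ex_minnP ex) => n kn nmin; exists n.
apply/eqP; rewrite eqn_leq kn andbT.
case: n kn nmin => [|n] kn nmin; first by have [_ _] := next_posP sigma b 0; apply.
have [_ _] := next_posP sigma b (pos sigma b n).+1; apply=> //.
by rewrite ltnNge; apply/negP => /nmin; rewrite ltnn.
Qed.

Lemma pos_inj sigma b : injective (pos sigma b).
Proof.
move=> m n e; case: (ltngtP m n) => // /(pos_homo sigma b); by rewrite e ltnn.
Qed.

Lemma ltn_pos sigma b n : 0 < pos sigma b n -> n < pos sigma b n.
Proof.
have step i j : i < pos sigma b i -> i <= j -> j < pos sigma b j.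
  move=> i_lt; elim: j => [|j IH]; first by rewrite leqn0 => /eqP <-.
  rewrite leq_eqVlt => /predU1P[<- //|/IH jlt].
  exact: leq_ltn_trans jlt (pos_homo _ _ (ltnSn j)).
case: (posnP (pos sigma b 0)) => [p0|p0 _]; last exact: step p0 _.
case: n => [|n _]; first by rewrite p0.
apply: (step 1) => //; case: (ltngtP 1 (pos sigma b 1)) (leq_pos sigma b 1) => // p1 _.
by have := pos_val sigma b 0; rewrite p0 binseq0 => /esym bE;
   have := pos_val sigma b 1; rewrite -p1 binseq1 bE.
Qed.

Definition is_transform (sigma : binseq) (tau : nat -> bool) : Prop :=
  [/\ forall n, tau (v_ sigma n) = tau n,
      forall n, tau (u_ sigma n) = ~~ tau n
    & tau 0 = false].

Lemma is_transform_pos sigma tau : is_transform sigma tau ->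
  forall b n, tau (pos sigma b n) = b (+) tau n.
Proof. by case=> tv tu _ [] n; [apply: tu | apply: tv]. Qed.

Lemma transform_unique sigma tau tau' :
  is_transform sigma tau -> is_transform sigma tau' -> tau =1 tau'.
Proof.
move=> H H' k; have [_ _ t0] := H; have [_ _ t0'] := H'.
elim/ltn_ind: k => k IH; case: (posnP k) => [->|k0]; first by rewrite t0 t0'.
have /posP[n nk] := erefl (sigma k).
rewrite -nk !is_transform_pos // IH //.
by rewrite -[X in _ < X]nk; apply: ltn_pos; rewrite nk.
Qed.

Lemma transform_exists sigma : {tau : nat -> bool | is_transform sigma tau}.
Proof.
have ex k : exists n, pos sigma (sigma k) n == k.
  by have /posP[n nk] := erefl (sigma k); exists n; apply/eqP.
pose rank k := ex_minn (ex k).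
have rankP k : pos sigma (sigma k) (rank k) = k.
  by rewrite /rank; case: ex_minnP => n /eqP.
pose fix F (f : nat) (k : nat) {struct f} : bool := if f is f'.+1 then sigma k (+) F f' (rank k) else false.
have rank_lt k : 0 < k -> rank k < k.
  by move=> k0; rewrite -[X in _ < X](rankP k); apply: ltn_pos; rewrite rankP.
have rank0 : rank 0 = 0.
  by apply/eqP; rewrite -leqn0 -[X in _ <= X](rankP 0) leq_pos.
have F0 f : F f 0 = false by elim: f => //= f; rewrite rank0 binseq0 => ->.
have FE f f' k : k <= f -> k <= f' -> F f k = F f' k.
  elim: f f' k => [|f IH] f' k; first by rewrite leqn0 => /eqP -> _; rewrite !F0.
  case: f' => [|f']; first by rewrite leqn0 => _ /eqP ->; rewrite !F0.
  case: (posnP k) => [-> _ _|k0 kf kf']; first by rewrite !F0.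
  by rewrite /= (IH f') // -ltnS; apply: leq_trans (rank_lt _ k0) _.
pose tau k := F k k.
have main b n : tau (pos sigma b n) = b (+) tau n.
  case: (posnP (pos sigma b n)) => [p0|p0].
    have n0 : n = 0 by apply/eqP; rewrite -leqn0 -p0 leq_pos.
    have b0 : b = false by have := pos_val sigma b n; rewrite p0 binseq0.
    by rewrite p0 n0 b0.
  have rk : rank (pos sigma b n) = n.
    by apply: (@pos_inj sigma b); have := rankP (pos sigma b n); rewrite pos_val.
  have := ltn_pos p0; rewrite /tau.
  case E: (pos sigma b n) p0 => [//|k] _ nk.
  by rewrite /= -E rk pos_val (FE k n).
by exists tau; split=> [n|n|//]; apply: main.
Qed.

Lemma transform_binseq0 (sigma : binseq) tau : is_transform sigma tau -> tau 0 = false.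
Proof. by case. Qed.

Lemma transform_binseq1 (sigma : binseq) tau : is_transform sigma tau -> tau 1 = true.
Proof.
move=> H; have [_ _ t0] := H.
suff <- : pos sigma true 0 = 1 by rewrite is_transform_pos // t0.
apply/eqP; rewrite eqn_leq; have [_ _ -> //=] := next_posP sigma true 0; last exact: binseq1.
by rewrite lt0n; apply/eqP => p0; have := pos_val sigma true 0; rewrite /= p0 binseq0.
Qed.

Lemma transform_binseq_inf (sigma : binseq) tau : is_transform sigma tau ->
  forall b N, exists n, (N <= n) && (tau n == b).
Proof.
move=> H.
have up b n : 0 < n -> n < pos sigma b n.
  by move=> n0; apply: ltn_pos; apply: leq_trans n0 (leq_pos _ _ _).
have ones N : exists n, [&& 0 < n, N <= n & tau n].
  elim: N => [|N [n /and3P[n0 Nn tn]]]; first by exists 1; rewrite (transform_binseq1 H).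
  exists (pos sigma false n); rewrite (is_transform_pos H false) tn andbT.
  by rewrite (leq_trans n0 (leq_pos _ _ _)) (leq_ltn_trans Nn (up _ _ n0)).
case=> N; have [n /and3P[n0 Nn tn]] := ones N; first by exists n; rewrite Nn tn.
exists (pos sigma true n); rewrite (is_transform_pos H true) tn andbT.
exact: leq_trans Nn (leq_pos _ _ _).
Qed.

(* The unique sequence satisfying is_transform (transform_unique); it is again
   in binseq, so the transform can be iterated. *)
Definition TM_transform (sigma : binseq) : binseq :=
  let: exist tau H := transform_exists sigma in
  BinSeq (transform_binseq0 H)
         (transform_binseq1 H) (transform_binseq_inf H).

Lemma TM_transformP sigma : is_transform sigma (TM_transform sigma).
Proof. by rewrite /TM_transform; case: (transform_exists sigma). Qed.

Definition tower (m : nat) : binseq := iter m TM_transform thue_morse_seq.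

(* Main.v *)
Require Import Defs.
From mathcomp Require Import all_boot.
From Stdlib Require PeanoNat.

(** Write [S p m] for the condition [p & m = 0]. By Kummer's theorem it says
that the binomial coefficient C(p + m, p) is odd, so it satisfies Pascal's rule
modulo 2: [S (p+1) (m+1) = S (p+1) m (+) S p (m+1)]. Let [f m] be the right-hand
side. As [S 0 m] holds, [f m] takes both values on every pair {2k, 2k+1}, so the
k-th position where it equals [b] is [2k + (b (+) f m (2k))], and the defining
equations of the transform reduce to [f (m+1) (2k) (+) f m (2k) = f (m+1) k],
which is Pascal's rule coefficient by coefficient. *)

Lemma land_eq0_half p m :
  (Nat.land p m == 0) = ~~ (odd p && odd m) && (Nat.land p./2 m./2 == 0).
Proof.
have oddE n : Nat.odd n = odd n.
  by elim/ltn_ind: n => -[|[|n]] //= IH; rewrite -IH // negbK.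
have halfE n : Nat.div2 n = n./2.
  by elim/ltn_ind: n => -[|[|n]] //= IH; rewrite IH.
have pE := odd_double_half p; rewrite addnC -mul2n in pE.
case: (odd p) pE => /=; rewrite ?addn0 => pE.
  have := PeanoNat.Nat.land_odd_l p./2 m.
  rewrite oddE halfE !plusE !multE pE => ->.
  by rewrite addn_eq0 muln_eq0 andbC; case: (odd m).
have := PeanoNat.Nat.land_even_l p./2 m.
by rewrite halfE !multE pE => ->; rewrite muln_eq0.
Qed.

Lemma land_eq0_pascal p m :
  (Nat.land p.+1 m.+1 == 0)
  = (Nat.land p.+1 m == 0) (+) (Nat.land p m.+1 == 0).
Proof.
elim/ltn_ind: p m => p IH m.
rewrite !(land_eq0_half p.+1) (land_eq0_half p m.+1) /= !uphalf_half.
case op: (odd p); case om: (odd m); rewrite /= ?add0n ?add1n ?addbF ?addbb //.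
(* Three parity patterns are settled by [land_eq0_half] alone. When [p] and [m] are both odd,
   halving every argument gives the same rule at [p./2] and [m./2]. *)
apply: IH; case: p op => [|p] //= _.
by rewrite ltnS leq_uphalf_double -addnn leq_addr.
Qed.

Definition xor_disjoint_bits (m n : nat) : bool :=
  \big[addb/false]_(p < n | Nat.land p m == 0) bit p n.

(** Position 0 is always selected because 0 & m = 0, and the higher bits of [n] are the bits of
    [n./2] shifted by one. The free bound [N] lets sums for different [m] and [n] be compared
    termwise. *)
Lemma xor_disjoint_bits_half m n N : n./2 <= N ->
  xor_disjoint_bits m n =
  odd n (+) \big[addb/false]_(p < N | Nat.land p.+1 m == 0) bit p n./2.
Proof.
move=> nN; rewrite /xor_disjoint_bits (@xor_widen m n (maxn n N).+1); last first.
  by rewrite ltnW // ltnS leq_maxl.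
rewrite big_mkcond big_ord_recl /= bit0; congr addb.
rewrite (big_ord_widen_cond (maxn n N) (fun p => Nat.land p.+1 m == 0)
  (bit^~ n./2)) ?leq_maxr //.
rewrite [RHS]big_mkcond; apply: eq_bigr => p _; rewrite -bitS.
case: eqP => //= _; case: ltnP => // Np.
by rewrite bitS bit_ge // (leq_trans nN).
Qed.

Lemma xor_disjoint_bits0 m : xor_disjoint_bits m 0 = false.
Proof. exact: big_ord0. Qed.

Lemma xor_disjoint_bits_doubleS m k :
  xor_disjoint_bits m k.*2.+1 = ~~ xor_disjoint_bits m k.*2.
Proof.
rewrite (@xor_disjoint_bits_half m k.*2.+1 k) ?(@xor_disjoint_bits_half m k.*2 k);
  by rewrite /= ?uphalf_double ?doubleK ?odd_double.
Qed.

Lemma xor_disjoint_bits_double m k :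
  xor_disjoint_bits m.+1 k.*2 (+) xor_disjoint_bits m k.*2
  = xor_disjoint_bits m.+1 k.
Proof.
rewrite !(@xor_disjoint_bits_half _ k.*2 k) ?doubleK // odd_double /=.
rewrite /xor_disjoint_bits big_mkcond [X in _ (+) X]big_mkcond [RHS]big_mkcond.
rewrite -big_split; apply: eq_bigr => p _ /=; rewrite land_eq0_pascal.
by do 2 case: eqP => _; rewrite ?addbb ?addbF.
Qed.

Lemma xor_disjoint_bits_thue_morse n : xor_disjoint_bits 0 n = thue_morse n.
Proof.
rewrite /xor_disjoint_bits /thue_morse /s2 (big_morph odd oddD (erefl _)).
by apply: eq_big => p; rewrite ?PeanoNat.Nat.land_0_r ?oddb.
Qed.

Lemma pos_of_alternating (sigma : binseq) b k :
  (forall j, sigma j.*2.+1 = ~~ sigma j.*2) ->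
  pos sigma b k = (b (+) sigma k.*2) + k.*2.
Proof.
move=> alt; pose P j := (b (+) sigma j.*2) + j.*2.
have sigmaP j : sigma (P j) = b.
  by rewrite /P; case E: (sigma j.*2); case Eb: b; rewrite /= ?alt ?E.
(* Each pair {2j, 2j+1} contains only one [b], so a position of [b] is determined by its half. *)
have posE q : sigma q = b -> q = P q./2.
  rewrite -{1 2}(odd_double_half q) /P; case: (odd q); rewrite /= ?add0n ?add1n ?alt => <-.
    by case: (sigma _).
  by rewrite addbb.
have ltP i j : (P i < P j) = (i < j).
  have incr i' j' : i' < j' -> P i' < P j'.
    move=> ij; rewrite /P; apply: (@leq_trans i'.+1.*2).
      by rewrite doubleS -addSn -add2n leq_add2r ltnS leq_b1.
    by rewrite (leq_trans _ (leq_addl _ _)) // leq_double.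
  case: (ltngtP i j) => [/incr //|/incr ji|->]; last by rewrite ltnn.
  by rewrite ltnNge ltnW.
have leP i j : (P i <= P j) = (i <= j) by rewrite leqNgt ltP -leqNgt.
elim: k => [|k IH] /=.
  have [_ /posE -> /(_ (P 0) isT (sigmaP 0))] := next_posP sigma b 0.
  by rewrite leP leqn0 => /eqP ->.
rewrite IH -/(P k) -/(P k.+1).
(* The next position is some [P j]: lying beyond [P k] forces k < j, and minimality against [P k.+1]
   forces j <= k + 1. *)
have [k_lt /posE qE /(_ (P k.+1))] := next_posP sigma b (P k).+1.
rewrite ltP sigmaP => /(_ (ltnSn k) erefl); move: k_lt.
by rewrite qE ltP leP => kq qk; congr P; apply/eqP; rewrite eqn_leq qk.
Qed.

Lemma xor_disjoint_bits_transform m (sigma : binseq) :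
  sigma =1 xor_disjoint_bits m -> is_transform sigma (xor_disjoint_bits m.+1).
Proof.
move=> sigmaE.
have posE b k : xor_disjoint_bits m.+1 (pos sigma b k)
                = b (+) xor_disjoint_bits m.+1 k.
  rewrite pos_of_alternating; last first.
    by move=> j; rewrite !sigmaE xor_disjoint_bits_doubleS.
  (* An offset of 1 from [k.*2] negates the value, so both sides equal [b] xored with the values at
     [k.*2] for [m.+1] and for [m]. *)
  rewrite -[in RHS]xor_disjoint_bits_double sigmaE.
  by case: b; case E: (xor_disjoint_bits m k.*2);
    rewrite /= ?add0n ?add1n ?xor_disjoint_bits_doubleS ?addbT ?addbF ?negbK.
by split=> [n|n|]; [exact: (posE false) | exact: (posE true)
                   | exact: xor_disjoint_bits0].
Qed.

Theorem theorem5 (m n : nat) :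
  tower m n = \big[addb/false]_(p < n | Nat.land p m == 0) bit p n.
Proof.
rewrite -/(xor_disjoint_bits m n); elim: m n => [|m IH] n.
  by rewrite xor_disjoint_bits_thue_morse.
exact: (transform_unique (TM_transformP (tower m))
         (xor_disjoint_bits_transform _ _ IH) n).
Qed.
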